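(* Let $n\geq 5$ and let $G=[g_{i,j}]_{1\le i,j\le n}$ be the Gram matrix of a complex equiangular $(n,m)$-frame. Let $1\leq i<j<k\leq n-2$ be indices, and put \[\Sigma:=\frac{n}{m}g_{i,j}-\sum_{\ell=1}^{n-2}g_{i,\ell}\overline{g_{j,\ell}},\qquad \Delta:=\frac{n}{m}g_{j,k}-\sum_{\ell=1}^{n-2}g_{j,\ell}\overline{g_{k,\ell}},\qquad \Psi:=\frac{n}{m}g_{k,i}-\sum_{\ell=1}^{n-2}g_{k,\ell}\overline{g_{i,\ell}}.\] Then \[\Sigma\Delta\Psi-\alpha_{n,m}^2\left(|\Sigma|^2+|\Delta|^2+|\Psi|^2-4\alpha_{n,m}^4\right)=0,\] where $\alpha_{n,m}=\sqrt{\frac{n-m}{m(n-1)}}$.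
   Context: For integers $n\ge m\ge 1$ (with $n\geq 2$), a complex equiangular tight frame, or complex equiangular $(n,m)$-frame, is a collection of $n$ unit vectors $\varphi_1,\dots,\varphi_n\in\mathbb{C}^m$ such that $|\langle\varphi_i,\varphi_j\rangle|=\alpha_{n,m}:=\sqrt{\frac{n-m}{m(n-1)}}$ for all $1\le i<j\le n$, and which is tight: the $m\times n$ matrix $F$ with columns $\varphi_1,\dots,\varphi_n$ has pairwise orthogonal rows of equal norm, i.e. $FF^\ast=\frac{n}{m}I_m$. Its Gram matrix is $G:=F^\ast F$; it is self-adjoint with unit diagonal, off-diagonal entries of modulus $\alpha_{n,m}$, and satisfies $mG^2=nG$. *)

(* Defs.v *)
From HB Require Import structures.
From mathcomp Require Import all_boot all_order all_algebra.
From mathcomp Require Import sesquilinear spectral.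
From mathcomp Require Import complex.
From mathcomp Require Import reals.

Set Implicit Arguments.
Unset Strict Implicit.
Unset Printing Implicit Defensive.

Import Order.TTheory GRing.Theory Num.Theory.
Local Open Scope ring_scope.
Local Open Scope sesquilinear_scope.

Definition alpha (R : realType) (n m : nat) : R :=
  Num.sqrt ((n%:R - m%:R) / (m%:R * (n%:R - 1))).

Definition inner (R : realType) (m : nat) (u v : 'cV[R[i]]_m) : R[i] :=
  \sum_(r < m) u r 0 * (v r 0)^*.

Definition enorm (R : realType) (m : nat) (u : 'cV[R[i]]_m) : R[i] :=
  sqrtC (inner u u).

Definition frame_mx (R : realType) (n m : nat) (phi : 'I_n -> 'cV[R[i]]_m) :
    'M[R[i]]_(m, n) :=
  \matrix_(r < m, j < n) phi j r 0.

Definition gram (R : realType) (n m : nat) (phi : 'I_n -> 'cV[R[i]]_m) :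
    'M[R[i]]_n :=
  (frame_mx phi)^t* *m frame_mx phi.

(* The norm on [R[i]] takes values in [R[i]], hence the injection [%:C]. *)
Record equiangular_frame (R : realType) (n m : nat)
    (phi : 'I_n -> 'cV[R[i]]_m) : Prop := EquiangularFrame {
  etf_n_ge2 : (2 <= n)%N;
  etf_m_ge1 : (1 <= m)%N;
  etf_m_le_n : (m <= n)%N;
  etf_unit : forall i : 'I_n, enorm (phi i) = 1;
  etf_equiangular : forall i j : 'I_n, (i < j)%N ->
    `|inner (phi i) (phi j)| = ((alpha R n m)%:C)%C;
  etf_tight :
    frame_mx phi *m (frame_mx phi)^t* = (n%:R / m%:R)%:M
}.

(* Main.v *)
Require Import Defs.
From HB Require Import structures.
From mathcomp Require Import all_boot all_order all_algebra.
From mathcomp Require Import complex.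
From mathcomp Require Import reals.
From mathcomp Require Import ring zify.

(** The Gram matrix satisfies [G *m G = (n / m) *: G] because the frame is
    tight, so each of [Sigma], [Delta], [Psi] is exactly the part of a row
    product of [G] that comes from the last two columns. Write [x] and [y] for
    these two columns, and a prime for complex conjugation:
    [Sigma = x_i x_j' + y_i y_j'], and cyclically. As the indices [i], [j], [k]
    avoid the last two, all the entries [x_p] and [y_p] have modulus [a].

    In the product [Sigma * Delta * Psi], the two pure terms telescope to
    [a ^ 6], since [x_i x_j' x_j x_k' x_k x_i' = a ^ 6]. In each of the six
    mixed terms one pair telescopes, as in
    [x_i x_j' x_j x_k' y_k y_i' = a ^ 2 x_k' x_i y_k y_i'];
    these are [a ^ 2] times the cross terms of the squared moduli
    [|Sigma| ^ 2 = 2 a ^ 4 + cross terms] and its analogues. Hence the product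
    is [2 a ^ 6 + a ^ 2 (|Sigma| ^ 2 + |Delta| ^ 2 + |Psi| ^ 2 - 6 a ^ 4)]. *)

Set Implicit Arguments.
Unset Strict Implicit.
Unset Printing Implicit Defensive.

Import Order.TTheory GRing.Theory Num.Theory.
Local Open Scope ring_scope.

Lemma gramE (R : realType) (n m : nat) (phi : 'I_n -> 'cV[R[i]]_m)
    (i j : 'I_n) :
  gram phi i j = inner (phi j) (phi i).
Proof. by rewrite mxE; apply: eq_bigr => r _; rewrite !mxE mulrC. Qed.

Lemma innerC (R : realType) (m : nat) (u v : 'cV[R[i]]_m) :
  inner v u = (inner u v)^*.
Proof.
by rewrite rmorph_sum; apply: eq_bigr => r _; rewrite rmorphM /= conjCK mulrC.
Qed.

Lemma gram_conj (R : realType) (n m : nat) (phi : 'I_n -> 'cV[R[i]]_m)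
    (i j : 'I_n) :
  (gram phi i j)^* = gram phi j i.
Proof. by rewrite !gramE -innerC. Qed.

Lemma norm_gram (R : realType) (n m : nat) (phi : 'I_n -> 'cV[R[i]]_m)
    (i j : 'I_n) :
  equiangular_frame phi -> i != j -> `|gram phi i j| = ((alpha R n m)%:C)%C.
Proof.
move=> etf; rewrite neq_ltn gramE => /orP[lt_ij | lt_ji].
  by rewrite innerC norm_conjC (etf_equiangular etf lt_ij).
exact: etf_equiangular etf _ _ lt_ji.
Qed.

Lemma gram_mul_conj (R : realType) (n m : nat) (phi : 'I_n -> 'cV[R[i]]_m)
    (i j : 'I_n) :
  equiangular_frame phi -> i != j ->
  gram phi i j * (gram phi i j)^* = ((alpha R n m)%:C)%C ^+ 2.
Proof. by move=> etf ij; rewrite -normCK norm_gram. Qed.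

Lemma gram_mulmx (R : realType) (n m : nat) (phi : 'I_n -> 'cV[R[i]]_m) :
  equiangular_frame phi ->
  gram phi *m gram phi = (n%:R / m%:R) *: gram phi.
Proof.
move=> etf; rewrite {1 2}/gram -mulmxA (mulmxA (frame_mx phi)).
by rewrite (etf_tight etf) mul_scalar_mx -scalemxAr.
Qed.

Lemma sum_gram (R : realType) (n m : nat) (phi : 'I_n -> 'cV[R[i]]_m)
    (i j : 'I_n) :
  equiangular_frame phi ->
  \sum_(l < n) gram phi i l * (gram phi j l)^* = n%:R / m%:R * gram phi i j.
Proof.
move=> /gram_mulmx /matrixP /(_ i j); rewrite !mxE => <-.
by apply: eq_bigr => l _; rewrite gram_conj.
Qed.

Lemma sum_ord_last2 (V : nmodType) (N : nat) (f : 'I_N.+2 -> V) :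
  \sum_(l < N.+2) f l
    = \sum_(l < N.+2 | (l < N)%N) f l + (f (inord N) + f ord_max).
Proof.
rewrite (bigID (fun l : 'I_N.+2 => (l < N)%N)) /=; congr (_ + _).
rewrite (bigD1 (inord N)) /=; last by rewrite inordK // ltnn.
rewrite (bigD1 ord_max) /=; last first.
  by rewrite -val_eqE /= inordK //; lia.
rewrite big1 ?addr0 // => l; rewrite -!val_eqE /= inordK //.
by have := ltn_ord l; lia.
Qed.

(** Tightness turns the defect of the truncated row product into the two
    omitted terms. *)
Lemma gram_defect (R : realType) (N m : nat) (phi : 'I_N.+2 -> 'cV[R[i]]_m)
    (i j : 'I_N.+2) :
  equiangular_frame phi ->
  N.+2%:R / m%:R * gram phi i j
      - \sum_(l < N.+2 | (l < N)%N) gram phi i l * (gram phi j l)^*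
    = gram phi i (inord N) * (gram phi j (inord N))^*
      + gram phi i ord_max * (gram phi j ord_max)^*.
Proof.
by move=> etf; rewrite -sum_gram // sum_ord_last2 addrAC subrr add0r.
Qed.

(** The algebraic core: three vectors [(x_p, y_p)] whose coordinates all have
    the same squared modulus [s], and their cyclic inner products. *)
Lemma triple_product_identity (C : numClosedFieldType)
    (s x1 x2 x3 y1 y2 y3 : C) :
  x1 * x1^* = s -> x2 * x2^* = s -> x3 * x3^* = s ->
  y1 * y1^* = s -> y2 * y2^* = s -> y3 * y3^* = s ->
  let S := x1 * x2^* + y1 * y2^* in
  let D := x2 * x3^* + y2 * y3^* in
  let P := x3 * x1^* + y3 * y1^* in
  S * D * P = s * (`|S| ^+ 2 + `|D| ^+ 2 + `|P| ^+ 2 - 4%:R * s ^+ 2).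
Proof.
move=> hx1 hx2 hx3 hy1 hy2 hy3 S D P.
rewrite !normCK /S /D /P !rmorphD !rmorphM /= !conjCK.
(* Once conjugation is pushed to the coordinates, the conjugates can be treated
   as independent variables subject to the six modulus relations. *)
move: (x1^*) (x2^*) (x3^*) (y1^*) (y2^*) (y3^*) hx1 hx2 hx3 hy1 hy2 hy3.
move=> u1 u2 u3 v1 v2 v3 hx1 hx2 hx3 hy1 hy2 hy3.
ring: hx1 hx2 hx3 hy1 hy2 hy3.
Qed.

(* Indices are 0-based: 1 <= i < j < k <= n-2 becomes i < j < k < n-2. *)
Theorem theorem2p4 (R : realType) (n m : nat) (phi : 'I_n -> 'cV[R[i]]_m)
    (G : 'M[R[i]]_n) (i j k : 'I_n) :
  (5 <= n)%N ->
  equiangular_frame phi ->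
  G = gram phi ->
  (i < j)%N -> (j < k)%N -> (k < n - 2)%N ->
  let a : R[i] := ((alpha R n m)%:C)%C in
  let Sigma := n%:R / m%:R * G i j
    - \sum_(l < n | (l < n - 2)%N) G i l * (G j l)^* in
  let Delta := n%:R / m%:R * G j k
    - \sum_(l < n | (l < n - 2)%N) G j l * (G k l)^* in
  let Psi := n%:R / m%:R * G k i
    - \sum_(l < n | (l < n - 2)%N) G k l * (G i l)^* in
  Sigma * Delta * Psi
    - a ^+ 2 * (`|Sigma| ^+ 2 + `|Delta| ^+ 2 + `|Psi| ^+ 2 - 4%:R * a ^+ 4)
  = 0.
Proof.
case: n phi G i j k => [|[|N]] // phi G i j k _ etf -> ij jk.
rewrite !subSS subn0 => kN a; rewrite /= !gram_defect //.
have mod_entry (p q : 'I_N.+2) : (p < N)%N -> (N <= val q)%N ->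
    gram phi p q * (gram phi p q)^* = a ^+ 2.
  move=> pN Nq; apply: gram_mul_conj => //.
  by rewrite -val_eqE neq_ltn (leq_trans pN Nq).
have jN := ltn_trans jk kN; have iN := ltn_trans ij jN.
have N_last : (N <= val (ord_max : 'I_N.+2))%N by [].
have N_penult : (N <= val (inord N : 'I_N.+2))%N by rewrite /= inordK.
apply/eqP; rewrite subr_eq0 -[4%N]/(2 * 2)%N exprM; apply/eqP.
by apply: triple_product_identity; apply: mod_entry.
Qed.
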